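(* Let $\mathcal{H}$ be a real Hilbert space, $C\subseteq\mathcal{H}$ nonempty, closed and convex, and $F:\mathcal{H}\to\mathcal{H}$ a mapping such that: (1) the solution set $SOL(C,F)=\{x^*\in C : \langle F(x^* ),x-x^*\rangle\ge 0 \text{ for all } x\in C\}$ is nonempty; (2) $F$ is monotone on $C$: $\langle F(x)-F(y),x-y\rangle\ge 0$ for all $x,y\in C$; (3) $F$ is Lipschitz continuous on $C$ with constant $L>0$: $\|F(x)-F(y)\|\le L\|x-y\|$ for all $x,y\in C$. Let $\{v^k\}_{k=0}^\infty$ be a bounded sequence in $\mathcal{H}$ and let $\{\lambda_k\}_{k=0}^\infty$ be scalars with $\lambda_k\ge 0$ for all $k\ge 0$ and $\sum_{k=0}^\infty\lambda_k<+\infty$. Then the sequence $\{x^k\}_{k=0}^\infty$ generated by the extragradient method with bounded perturbations (described in the context) converges weakly to a solution of the variational inequality, i.e. to a point of $SOL(C,F)$.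
   Context: $P_C$ denotes the metric projection of $\mathcal{H}$ onto $C$. Extragradient method with bounded perturbations. Fix $\sigma>0$, $\rho\in(0,1)$, $\mu\in(0,1)$. Start from any $x^0\in C$ and, for $k\ge 0$, set $$y^k=P_C\big((x^k+\lambda_kv^k)-\gamma_kF(x^k+\lambda_kv^k)\big),\qquad x^{k+1}=P_C\big((x^k+\lambda_kv^k)-\gamma_kF(y^k)\big),$$ where $\gamma_k=\sigma\rho^{m_k}$ and $m_k$ is the smallest nonnegative integer such that (with $y^k$ computed using this $\gamma_k$) $$\gamma_k\|F(x^k+\lambda_kv^k)-F(y^k)\|\le\mu\big(\|x^k-y^k\|+\lambda_k\|v^k\|\big).$$ It is a standing assumption that $x^k+\lambda_kv^k\in C$ for all $k\ge 0$. *)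

(* Defs.v *)
From mathcomp Require Import all_boot all_order all_algebra.
From mathcomp Require Import all_classical all_reals all_analysis.
Set Implicit Arguments.
Unset Strict Implicit.
Unset Printing Implicit Defensive.
Import Order.TTheory GRing.Theory Num.Theory.
Import numFieldNormedType.Exports.
Local Open Scope classical_set_scope.
Local Open Scope ring_scope.

(* A real Hilbert space is a complete normed space H together with an inner
   product ip : {dot H for idfun} inducing its norm.  The form is
   theta-sesquilinear in MathComp; theta = idfun makes it a symmetric bilinear
   form, and positive definiteness is part of {dot H for _}. *)
Definition norm_induced_by (R : realType) (H : normedModType R)
    (ip : {dot H for idfun}) : Prop :=
  forall u : H, `|u| = Num.sqrt (ip u u).

(* The default value u of xget is irrelevant when C is nonempty, closed and
   convex in a Hilbert space: the nearest point then exists and is unique. *)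
Definition metric_proj (R : realType) (H : normedModType R) (C : set H)
    (u : H) : H :=
  xget u [set p | C p /\ forall z, C z -> `|u - p| <= `|u - z|].

Definition SOL (R : realType) (H : lmodType R) (ip : {dot H for idfun})
    (C : set H) (F : H -> H) : set H :=
  [set p | C p /\ forall x, C x -> 0 <= ip (F p) (x - p)].

Definition monotone_on (R : realType) (H : lmodType R)
    (ip : {dot H for idfun}) (C : set H) (F : H -> H) : Prop :=
  forall x y, C x -> C y -> 0 <= ip (F x - F y) (x - y).

Definition weakly_cvg_to (R : realType) (H : lmodType R)
    (ip : {dot H for idfun}) (x : nat -> H) (p : H) : Prop :=
  forall w : H, (fun k => ip (x k) w) @ \oo --> ip p w.

Section extragradient.
Variables (R : realType) (H : normedModType R) (C : set H) (F : H -> H).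

(* Below, w stands for the perturbed iterate x^k + lambda_k v^k. *)
Definition eg_trial (w : H) (gamma : R) : H :=
  metric_proj C (w - gamma *: F w).

(* x, lam and v are x^k, lambda_k and v^k, and the trial point plays y^k. *)
Definition eg_step_ok (mu : R) (x : H) (lam : R) (v : H) (gamma : R) : Prop :=
  let w := x + lam *: v in
  gamma * `|F w - F (eg_trial w gamma)|
    <= mu * (`|x - eg_trial w gamma| + lam * `|v|).

Definition perturbed_extragradient (sigma rho mu : R) (lam : nat -> R)
    (v x y : nat -> H) (m : nat -> nat) : Prop :=
  C (x 0%N) /\
  forall k : nat,
    let w := x k + lam k *: v k in
    let gamma := sigma * rho ^+ m k in
    [/\ eg_step_ok mu (x k) (lam k) (v k) gamma,
        forall j : nat, (j < m k)%N ->
          ~ eg_step_ok mu (x k) (lam k) (v k) (sigma * rho ^+ j),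
        y k = metric_proj C (w - gamma *: F w) &
        x k.+1 = metric_proj C (w - gamma *: F (y k))].

End extragradient.

(* Main.v *)
Require Import Defs.
From mathcomp Require Import all_boot all_order all_algebra.
From mathcomp Require Import all_classical all_reals all_analysis.
From mathcomp Require Import ring lra.
Set Implicit Arguments.
Unset Strict Implicit.
Unset Printing Implicit Defensive.
Import Order.TTheory GRing.Theory Num.Theory.
Import numFieldNormedType.Exports.
Local Open Scope classical_set_scope.
Local Open Scope ring_scope.

(* Write w_k = x_k + lambda_k v_k and let p be a solution.  The projection
   inequalities for y_k and x_{k+1}, monotonicity and the step rule give
     |x_{k+1} - p|^2 <= |w_k - p|^2 - (1 - mu) |w_k - y_k|^2 + c e_k^2,
   where e_k >= lambda_k |v_k| is summable; the c e_k^2 comes from the step rule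
   being stated with |x_k - y_k| + lambda_k |v_k| instead of |w_k - y_k|.  Hence
   |x_k - p| converges (quasi-Fejer monotonicity) and w_k - y_k -> 0.  A rejected
   step exceeds mu / L, so gamma_k is bounded away from 0, and the projection
   inequality for y_k passes to the limit: a weak limit q of x_k along an
   ultrafilter satisfies <F z, z - q> >= 0 on C, so q is a solution by Minty's
   argument.  Opial's argument shows that all these limits coincide. *)

(** * Inner product identities and the Cauchy-Schwarz inequality *)

Section InnerProduct.
Variables (R : realType) (H : normedModType R) (ip : {dot H for idfun}).
Implicit Types (u v w : H) (a : R).

Lemma ipDl u v w : ip (u + v) w = ip u w + ip v w.
Proof. exact: linearDl. Qed.

Lemma ipDr u v w : ip w (u + v) = ip w u + ip w v.
Proof. exact: linearDr. Qed.

Lemma ipNl u w : ip (- u) w = - ip u w.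
Proof. exact: linearNl. Qed.

Lemma ipNr u w : ip w (- u) = - ip w u.
Proof. exact: linearNr. Qed.

Lemma ipZl a u w : ip (a *: u) w = a * ip u w.
Proof. exact: linearZl_LR. Qed.

Lemma ipZr a u w : ip w (a *: u) = a * ip w u.
Proof. exact: linearZr_LR. Qed.

Lemma ip0r w : ip w 0 = 0.
Proof. exact: linear0r. Qed.

Definition ipE := (ipDl, ipDr, ipNl, ipNr, ipZl, ipZr).

Lemma ipC u v : ip u v = ip v u.
Proof. by rewrite hermC expr0 mul1r. Qed.

Hypothesis hip : norm_induced_by ip.

Lemma ip_ge0 u : 0 <= ip u u.
Proof.
have [->|u0] := eqVneq u 0; first by rewrite ip0r.
exact/ltW/neq0_dnorm_gt0.
Qed.

Lemma ip_norm u : ip u u = `|u| ^+ 2.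
Proof. by rewrite hip sqr_sqrtr// ip_ge0. Qed.

Lemma norm_sqrD u v : `|u + v| ^+ 2 = `|u| ^+ 2 + 2 * ip u v + `|v| ^+ 2.
Proof. by rewrite -!ip_norm !ipE (ipC v u); ring. Qed.

Lemma norm_sqrB u v : `|u - v| ^+ 2 = `|u| ^+ 2 - 2 * ip u v + `|v| ^+ 2.
Proof. by rewrite norm_sqrD normrN ipNr mulrN. Qed.

(** Expand the square of the norm of [|v| u - |u| v], which is nonnegative, and cancel
    [2 |u| |v|]. *)
Lemma ip_le u v : ip u v <= `|u| * `|v|.
Proof.
have [->|u0] := eqVneq u 0; first by rewrite ipC ip0r normr0 mul0r.
have [->|v0] := eqVneq v 0; first by rewrite ip0r normr0 mulr0.
have nu : 0 < `|u| by rewrite normr_gt0.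
have nv : 0 < `|v| by rewrite normr_gt0.
have := ip_ge0 (`|v| *: u - `|u| *: v).
rewrite !ipE !ip_norm (ipC v u) => h.
have : 0 <= 2 * (`|u| * `|v|) * (`|u| * `|v| - ip u v) by nra.
by rewrite pmulr_rge0 ?subr_ge0// !mulr_gt0.
Qed.

Lemma normr_ip_le u v : `|ip u v| <= `|u| * `|v|.
Proof. by rewrite ler_norml ip_le andbT lerNl -ipNl -(normrN u) ip_le. Qed.

End InnerProduct.

(** * Quadratic minimization over a closed convex set and the metric projection *)

Section Projection.
Variables (R : realType) (H : completeNormedModType R).
Variables (ip : {dot H for idfun}) (hip : norm_induced_by ip) (C : set H).
Hypotheses (C_neq0 : C !=set0) (C_closed : closed C).
Hypothesis (C_convex : convex_set (C : set (convex_lmodType H))).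

Lemma convex_set_segment u v (t : R) : C u -> C v -> 0 <= t <= 1 ->
  C (u + t *: (v - u)).
Proof.
move=> Cu Cv /andP[t0 t1].
have := C_convex (Itv01 t0 t1) (mem_set Cv) (mem_set Cu).
rewrite inE /conv /= /unstable.onem.
congr C; rewrite scalerBl scalerBr scale1r addrC -addrA.
by congr (u + _); rewrite addrC.
Qed.

(* Applied to [l := ip u] this is the projection of [u] onto [C]; applied to
   [C := setT] it is the Riesz representation of [l]. *)
Lemma convex_variational_min (l : H -> R) (M : R) :
  linear_for *%R l -> (forall u, l u <= M * `|u|) ->
  exists2 p, C p & forall z, C z -> l (z - p) <= ip p (z - p).
Proof.
move=> l_lin l_bnd.
have l0 : l 0 = 0.
  by have := l_lin 1 0 0; rewrite scaler0 addr0 mul1r; lra.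
have lD u v : l (u + v) = l u + l v.
  by have := l_lin 1 u v; rewrite scale1r mul1r.
have lZ a u : l (a *: u) = a * l u.
  by have := l_lin a u 0; rewrite addr0 l0 addr0.
have lN u : l (- u) = - l u by rewrite -scaleN1r lZ mulN1r.
(* The required inequality is the first-order condition for a minimizer of [J] over [C]. *)
pose J u := ip u u - 2 * l u.
have J_ge u : - M ^+ 2 <= J u.
  have := l_bnd u; have := sqr_ge0 (`|u| - M).
  by rewrite /J (ip_norm hip); nra.
have [z0 Cz0] := C_neq0.
have infJ : has_inf (J @` C).
  split; first by exists (J z0), z0.
  by exists (- M ^+ 2) => _ [u _ <-].
set d := inf (J @` C).
have J_inf z : C z -> d <= J z.
  by move=> Cz; apply: ge_inf; [case: infJ|exists z].
have minimizing n : exists u, C u /\ J u < d + n.+1%:R^-1.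
  have [|_ [u Cu <-] Ju] := @inf_adherent _ _ n.+1%:R^-1 _ infJ.
    by rewrite invr_gt0.
  by exists u.
have [u_ u_min] := choice minimizing.
(* Parallelogram law: [J (u_ n) + J (u_ k)] minus twice [J] at the midpoint is half the left side,
   and the midpoint lies in [C], so [J] is at least [d] there. *)
have u_dist n k : `|u_ n - u_ k| ^+ 2 <= 2 * (n.+1%:R^-1 + k.+1%:R^-1).
  have [Cn Jn] := u_min n; have [Ck Jk] := u_min k.
  have /J_inf : C (u_ n + 2^-1 *: (u_ k - u_ n)).
    by apply: convex_set_segment => //; lra.
  rewrite -(ip_norm hip) /J !ipE !lD lZ lD lN (ipC ip (u_ k)).
  move: Jn Jk; rewrite /J.
  by move: (n.+1%:R^-1) (k.+1%:R^-1) => a b; lra.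
have cvg_inv : (n.+1%:R^-1 : R) @[n --> \oo] --> (0 : R) by exact: cvg_harmonic.
have : cvgn u_.
  apply: cauchy_cvg; apply: cauchy_exP => e e0.
  have e2 : 0 < e ^+ 2 / 4 by rewrite divr_gt0// exprn_gt0.
  have /cvgr0_norm_lt/(_ _ e2)[N _ hN] := cvg_inv.
  exists (u_ N), N => // n /= Nn; rewrite -ball_normE /=.
  rewrite -(ltr_pXn2r (n := 2)) ?nnegrE ?(ltW e0)//.
  have := hN N (leqnn N); have := hN n Nn.
  rewrite /= !ger0_norm ?invr_ge0// => a b.
  apply: le_lt_trans (u_dist N n) _.
  by move: a b; move: (n.+1%:R^-1) (N.+1%:R^-1) => a b; lra.
move=> /cvg_ex[p up].
have Cp : C p.
  apply: (closed_cvg _ C_closed _ _ up); near=> n.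
  by have [] := u_min n.
have up0 : `|p - u_ n| @[n --> \oo] --> (0 : R).
  rewrite -(normr0 H) -(subrr p); apply: cvg_norm.
  exact: cvgB (cvg_cst _) up.
exists p => // z Cz.
(* Continuity of [J] along [u_] is made quantitative: [J p - J (u_ n)] equals [ip (p - u_ n) (p + u_
   n) - 2 * l (p - u_ n)], which is at most a multiple of [|p - u_ n|]. *)
have J_min z' : C z' -> J p <= J z'.
  move=> Cz'; apply: le_trans (J_inf _ Cz').
  rewrite -subr_le0.
  have h :
      `|p - u_ n| * (2 * `|p| + `|p - u_ n| + 2 * M) + n.+1%:R^-1
      @[n --> \oo] --> (0 * (2 * `|p| + 0 + 2 * M) + 0 : R).
    apply: cvgD => //; apply: cvgM => //; apply: cvgD; last exact: cvg_cst.
    by apply: cvgD => //; exact: cvg_cst.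
  rewrite mul0r addr0 in h; apply: (cvgr_to_ge h); near=> n.
  have [_ Jn] := u_min n.
  have := ip_le hip (p - u_ n) (p + u_ n).
  have := l_bnd (u_ n - p); rewrite distrC => lb.
  have : `|p + u_ n| <= 2 * `|p| + `|p - u_ n|.
    have -> : p + u_ n = p + p - (p - u_ n)
      by rewrite opprB [RHS]addrC addrA subrK addrC.
    rewrite (le_trans (ler_normB _ _))// lerD2r (le_trans (ler_normD _ _))//.
    by rewrite mulr_natl mulr2n.
  move=> /(ler_wpM2l (normr_ge0 (p - u_ n))).
  move: Jn lb; rewrite /J !ipE lD lN (ipC ip (u_ n)).
  by move: (n.+1%:R^-1) => a; lra.
(* Compare [J p] with [J] at [p + t (z - p)] and divide by [2 t]; the remainder vanishes as [t]
   tends to 0. *)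
have Q (t : R) : 0 < t -> t <= 1 ->
    l (z - p) - ip p (z - p) <= t / 2 * `|z - p| ^+ 2.
  move=> t0 t1; have /J_min : C (p + t *: (z - p)).
    by apply: convex_set_segment => //; rewrite ltW.
  rewrite -(ip_norm hip) /J; move: (z - p) => w.
  rewrite !ipE lD lZ (ipC ip w) => h.
  rewrite -(ler_pM2l t0); nra.
rewrite -subr_le0; apply/ler_addgt0Pl => e e0; rewrite addr0.
have [zp|zp] := eqVneq (`|z - p| ^+ 2) 0.
  have := Q 1 ltr01 (lexx _); rewrite zp mulr0 => /le_trans; apply.
  exact: ltW.
have zp0 : 0 < `|z - p| ^+ 2 by rewrite lt_neqAle eq_sym zp sqr_ge0.
pose t := Num.min 1 (e / `|z - p| ^+ 2).
have t0 : 0 < t by rewrite lt_min ltr01 divr_gt0.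
have t1 : t <= 1 by rewrite ge_min lexx.
have te : t * `|z - p| ^+ 2 <= e by rewrite -ler_pdivlMr// ge_min lexx orbT.
by apply: le_trans (Q t t0 t1) _; lra.
Unshelve. all: by end_near.
Qed.

(** The variational point [p] for [l := ip u] satisfies [|u - p|^2 + |p - z|^2 <= |u - z|^2] on [C].
    Hence nearest points exist, so [xget] does not return its default, and the chosen one must be
    [p]. *)
Lemma metric_projP u : C (metric_proj C u) /\
  forall z, C z -> ip (u - metric_proj C u) (z - metric_proj C u) <= 0.
Proof.
have [|v|p Cp p_var] := @convex_variational_min (ip u) `|u|.
- by move=> a v w; rewrite !ipE.
- exact: ip_le.
have {}p_var z : C z -> ip (u - p) (z - p) <= 0.
  by move=> /p_var; rewrite ipDl ipNl subr_le0.
have p_near z : C z -> `|u - p| ^+ 2 + `|p - z| ^+ 2 <= `|u - z| ^+ 2.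
  move=> /p_var; rewrite -(opprB p z) ipNr oppr_le0 => h.
  have -> : u - z = (u - p) + (p - z) by rewrite addrA subrK.
  by rewrite (norm_sqrD hip (u - p)); lra.
have ex_near : [set p | C p /\ forall z, C z -> `|u - p| <= `|u - z|] !=set0.
  exists p; split=> // z /p_near h; rewrite -(ler_pXn2r (n := 2)) ?nnegrE//.
  by apply: le_trans h; rewrite lerDl sqr_ge0.
have [] := xgetPex u ex_near; rewrite -/(metric_proj C u) => CP P_near.
suff -> : metric_proj C u = p by [].
apply/esym/eqP; rewrite -subr_eq0 -normr_eq0 -sqrf_eq0 -(ip_norm hip).
rewrite eq_le (ip_ge0 ip) andbT (ip_norm hip).
have := p_near _ CP; have := P_near _ Cp.
rewrite -(ler_pXn2r (n := 2)) ?nnegrE//; lra.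
Qed.

End Projection.

(** * Weak limits along ultrafilters and Opial's argument *)

Section WeakLimits.
Variables (R : realType) (H : completeNormedModType R).
Variables (ip : {dot H for idfun}) (hip : norm_induced_by ip).

(** The values stay in a compact segment, hence have a cluster point, and a cluster point of an
    ultrafilter is a limit. *)
Lemma ultrafilter_bounded_cvg (T : Type) (G : set_system T) (f : T -> R) M :
  UltraFilter G -> (forall t, `|f t| <= M) -> cvg (f t @[t --> G]).
Proof.
move=> GU f_bnd.
have f_itv : (f @ G) `[- M, M]%classic.
  by apply: (@filterE _ G) => t /=; rewrite in_itv /= -ler_norml.
have [l [_ l_cluster]] := segment_compact (fmap_proper_filter f _) f_itv.
apply/cvg_ex; exists l => A lA.
have [//|GnA] := in_ultra_setVsetC (f @^-1` A) GU.
by have [? []] := l_cluster (~` A) A GnA lA.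
Qed.

(** The scalar limits of [ip (x t) w] depend linearly on [w] and are bounded by [M |w|]; Riesz
    representation yields [q]. *)
Lemma ultrafilter_weak_limit (T : Type) (G : set_system T) (x : T -> H) M :
  UltraFilter G -> (forall t, `|x t| <= M) ->
  exists q, forall w, ip (x t) w @[t --> G] --> ip q w.
Proof.
move=> GU x_bnd.
have ex_lim w : exists l : R, ip (x t) w @[t --> G] --> l.
  apply/cvg_ex; apply: (@ultrafilter_bounded_cvg _ _ _ (M * `|w|)) => t.
  by apply: le_trans (normr_ip_le hip _ _) _; rewrite ler_wpM2r.
have [l l_lim] := choice ex_lim.
have [|||||q _ q_var] := @convex_variational_min R H ip hip setT _ _ _ l M.
- by exists 0.
- exact: closedT.
- by move=> *; rewrite in_setT.
- move=> a u v; apply: (cvg_unique _ (l_lim _)) => //=.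
  under eq_cvg do rewrite ipDr ipZr.
  by apply: cvgD => //; apply: cvgM => //; exact: cvg_cst.
- move=> u; apply: (cvgr_to_le (l_lim u)); near=> t.
  by apply: le_trans (ip_le hip _ _) _; rewrite ler_wpM2r.
exists q => w; suff -> : ip q w = l w by [].
have lN u : l (- u) = - l u.
  apply: (cvg_unique _ (l_lim _)) => //=.
  under eq_cvg do rewrite ipNr.
  exact: cvgN.
(* Over the whole space, testing in the directions [w] and [- w] turns the inequality into an
   equality. *)
have := q_var (q + w) I; have := q_var (q - w) I.
by rewrite addrAC subrr sub0r addrAC subrr add0r lN ipNr; lra.
Unshelve. all: by end_near.
Qed.

(* Ultrafilters replace the extraction of weakly convergent subsequences. *)
Lemma opial (S : set H) (x : nat -> H) M :
  (forall k, `|x k| <= M) ->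
  (forall p, S p -> cvgn (fun k => `|x k - p|)) ->
  (forall (G : set_system nat) q, UltraFilter G -> \oo `<=` G ->
    (forall w, ip (x k) w @[k --> G] --> ip q w) -> S q) ->
  exists2 p, S p & weakly_cvg_to ip x p.
Proof.
move=> x_bnd x_dist x_lim.
(* By polarization [ip (x k) (q1 - q2)] is an affine function of [|x k - q1|^2 - |x k - q2|^2], so
   it converges along [\oo]. Its limit is both [ip q1 (q1 - q2)] and [ip q2 (q1 - q2)], whence
   [|q1 - q2|^2 = 0]. *)
have uniq_lim (G1 G2 : set_system nat) q1 q2 :
    UltraFilter G1 -> \oo `<=` G1 -> UltraFilter G2 -> \oo `<=` G2 ->
    (forall w, ip (x k) w @[k --> G1] --> ip q1 w) ->
    (forall w, ip (x k) w @[k --> G2] --> ip q2 w) -> q1 = q2.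
  move=> U1 oo1 U2 oo2 lim1 lim2.
  have S1 := x_lim _ _ U1 oo1 lim1; have S2 := x_lim _ _ U2 oo2 lim2.
  have /cvg_ex[l xl] : cvgn (fun k => ip (x k) (q1 - q2)).
    rewrite [X in cvgn X](_ : _ = fun k =>
      2^-1 * (`|q1| ^+ 2 - `|q2| ^+ 2 - (`|x k - q1| ^+ 2 - `|x k - q2| ^+ 2))).
      apply: is_cvgM; first exact: is_cvg_cst.
      apply: is_cvgB; first exact: is_cvg_cst.
      by apply: is_cvgB; apply: is_cvgM; exact: x_dist.
    apply/funext => k; rewrite !(norm_sqrB hip) ipDr ipNr.
    by field.
  have l1 : l = ip q1 (q1 - q2).
    apply: (cvg_unique _ (cvg_trans (cvg_app _ oo1) xl) (lim1 (q1 - q2))) => //.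
  have l2 : l = ip q2 (q1 - q2).
    apply: (cvg_unique _ (cvg_trans (cvg_app _ oo2) xl) (lim2 (q1 - q2))) => //.
  apply/eqP; rewrite -subr_eq0 -normr_eq0 -sqrf_eq0 -(ip_norm hip).
  by rewrite ipDl ipNl -l1// -l2// subrr.
have [G [GU ooG]] := @ultraFilterLemma _ (\oo : set_system nat) _.
have [q q_lim] := ultrafilter_weak_limit GU x_bnd.
exists q; first exact: x_lim q_lim.
move=> w; apply/cvgrPdist_lt => e e0.
pose A := [set k | `|ip q w - ip (x k) w| < e].
suff : \forall k \near \oo, A k by [].
(* Otherwise some ultrafilter finer than [\oo] contains the complement of [A]; its weak limit is
   again [q], so it contains [A] too. *)
apply: contrapT => nA.
have W_proper : ProperFilter (within (~` A) (\oo : set_system nat)).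
  split; last exact: within_filter.
  move=> h; have {}h : \forall k \near \oo, ~ ~ A k := h.
  by apply: nA; near=> k; apply: contrapT; near: k.
have [G' [GU' WG']] := @ultraFilterLemma _ _ W_proper.
have ooG' : \oo `<=` G'.
  by move=> B ooB; apply: WG'; exact: (@cvg_within _ _ _ _ B ooB).
have [q' q'_lim] := ultrafilter_weak_limit GU' x_bnd.
have qq' : q = q' by exact: (uniq_lim G G').
have G'A : G' A.
  by have /cvgrPdist_lt/(_ _ e0) := q'_lim w; rewrite -qq'.
have G'nA : G' (~` A) by apply: WG'; exact: withinT.
by have [k []] := filter_ex (filterI G'A G'nA).
Unshelve. all: by end_near.
Qed.

End WeakLimits.

(** * Quasi-Fejer sequences and bounded functions *)

(** Subtracting the partial sums of [e] makes [d] nonincreasing, and the difference is bounded below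
    by minus the sum of the series. *)
Lemma quasi_fejer_cvg (R : realType) (d e : nat -> R) :
  (forall k, 0 <= d k) -> (forall k, 0 <= e k) -> cvgn (series e) ->
  (forall k, d k.+1 <= d k + e k) -> cvgn d.
Proof.
move=> d0 e0 e_cvg d_le.
have e_nd : nondecreasing_seq (series e).
  by apply/nondecreasing_seqP => k; rewrite seriesSr lerDl.
have -> : d = (d \- series e) \+ series e.
  by apply/funext => k /=; rewrite subrK.
apply: is_cvgD => //; apply: nonincreasing_is_cvgn.
  apply/nonincreasing_seqP => k /=; rewrite seriesSr opprD.
  by have := d_le k; lra.
exists (- limn (series e)) => _ [k _ <-] /=.
have := nondecreasing_cvgn_le e_nd e_cvg k; have := d0 k; lra.
Qed.

Lemma bounded_fun_le (R : realType) (T : Type) (V : normedModType R)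
    (f : T -> V) :
  bounded_fun f -> exists2 M, 0 <= M & forall t, `|f t| <= M.
Proof.
move=> /pinfty_ex_gt0[M M0 fM]; exists M; first exact: ltW.
by move=> t; apply: fM.
Qed.

(** * Estimates for one extragradient step, and tools for identifying weak limits *)

Section Extragradient.
Variables (R : realType) (H : completeNormedModType R).
Variables (ip : {dot H for idfun}) (hip : norm_induced_by ip).
Implicit Types (w y p P : H) (gamma mu e L : R).

(** In terms of [w - y], [P - y] and [y - p], this is a linear combination of the two projection
    inequalities and [gamma] times the third; [fw] and [fy] stand for the values of [F] at [w] and
    [y]. *)
Lemma extragradient_step w y p P fw fy gamma :
  0 <= gamma ->
  ip (w - gamma *: fw - y) (P - y) <= 0 ->
  ip (w - gamma *: fy - P) (p - P) <= 0 ->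
  0 <= ip fy (y - p) ->
  `|P - p| ^+ 2 <= `|w - p| ^+ 2 - `|w - y| ^+ 2 - `|P - y| ^+ 2
                   + 2 * (gamma * ip (fw - fy) (P - y)).
Proof.
move=> g0.
have -> : w - gamma *: fw - y = (w - y) - gamma *: fw by rewrite addrAC.
have -> : w - gamma *: fy - P = (w - y) - (P - y) - gamma *: fy.
  by rewrite opprB subrKA addrAC.
have -> : p - P = - ((P - y) + (y - p)) by rewrite subrKA opprB.
have -> : P - p = (P - y) + (y - p) by rewrite subrKA.
have -> : w - p = (w - y) + (y - p) by rewrite subrKA.
move: (w - y) (P - y) (y - p) => a b c.
rewrite -!(ip_norm hip) !ipE (ipC ip c a) (ipC ip c b).
move=> h1 h2 /(mulr_ge0 g0); lra.
Qed.

(** The step rule bounds the cross term of [extragradient_step]. Its part [2 mu |w - y| |P - y|] is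
    split evenly between the two squares; the part with [e] is absorbed by what remains of
    [|P - y|^2], at the cost of the last term. *)
Lemma extragradient_descent w y p P fw fy gamma mu e :
  0 <= gamma -> 0 < mu -> mu < 1 -> 0 <= e ->
  ip (w - gamma *: fw - y) (P - y) <= 0 ->
  ip (w - gamma *: fy - P) (p - P) <= 0 ->
  0 <= ip fy (y - p) ->
  gamma * `|fw - fy| <= mu * (`|w - y| + 2 * e) ->
  `|P - p| ^+ 2 <= `|w - p| ^+ 2 - (1 - mu) * `|w - y| ^+ 2
                   + 8 * mu ^+ 2 / (1 - mu) * e ^+ 2.
Proof.
move=> g0 mu0 mu1 e0 y_proj P_proj fy_ge0 step.
have := extragradient_step g0 y_proj P_proj fy_ge0.
have : gamma * ip (fw - fy) (P - y) <= mu * (`|w - y| + 2 * e) * `|P - y|.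
  apply: le_trans (ler_wpM2r (normr_ge0 (P - y)) step).
  by rewrite -mulrA ler_wpM2l// ip_le.
set c := 8 * mu ^+ 2 / (1 - mu).
have mu1' : 0 < 1 - mu by lra.
(* [4 mu e b <= (1 - mu) b^2 / 2 + c e^2], by completing the square *)
have : 4 * mu * e * `|P - y| <= (1 - mu) * `|P - y| ^+ 2 / 2 + c * e ^+ 2.
  have := sqr_ge0 ((1 - mu) * `|P - y| - 4 * mu * e).
  move=> h; rewrite -subr_ge0 -(pmulr_rge0 _ mu1').
  have -> : (1 - mu) * ((1 - mu) * `|P - y| ^+ 2 / 2 + c * e ^+ 2
      - 4 * mu * e * `|P - y|) = ((1 - mu) * `|P - y| - 4 * mu * e) ^+ 2 / 2.
    by rewrite /c; field; rewrite gt_eqF.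
  by rewrite divr_ge0.
have := sqr_ge0 (`|w - y| - `|P - y|); nra.
Qed.

(** With [y] the trial point, rejection and the Lipschitz bound give [mu |w - y| < gamma L |w - y|];
    strictness forces [w] and [y] to differ, so the norm cancels. *)
Lemma failed_step_bound (C : set H) (F : H -> H) L mu (x v : H)
    (lam gamma : R) :
  C !=set0 -> closed C -> convex_set (C : set (convex_lmodType H)) ->
  L.-lipschitz_C F -> 0 <= mu -> 0 <= gamma -> 0 <= lam -> C (x + lam *: v) ->
  ~ eg_step_ok C F mu x lam v gamma -> mu < gamma * L.
Proof.
move=> C0 Cc Cx FL mu0 g0 lam0; set w := x + lam *: v => Cw.
have [Cy _] := metric_projP hip C0 Cc Cx (w - gamma *: F w).
move/negP; rewrite /eg_step_ok -/w -/(eg_trial C F w gamma) -ltNge.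
rewrite -/(eg_trial C F w gamma) in Cy; set y := eg_trial C F w gamma in Cy *.
have wy : `|w - y| <= `|x - y| + lam * `|v|.
  have -> : w - y = (x - y) + lam *: v by rewrite addrAC.
  by rewrite (le_trans (ler_normD _ _))// normrZ ger0_norm.
have := FL (w, y) (conj Cw Cy) => /= Fwy lt.
have {}lt : mu * `|w - y| < gamma * L * `|w - y|.
  rewrite -mulrA (lt_le_trans _ (ler_wpM2l g0 Fwy))// (le_lt_trans _ lt)//.
  exact: ler_wpM2l.
have wy0 : 0 < `|w - y|.
  rewrite lt_neqAle normr_ge0 andbT; apply: contraTneq lt => <-.
  by rewrite !mulr0 ltxx.
by move: lt; rewrite ltr_pM2r.
Qed.

(** Test the hypothesis at [q + t (z - q)] and divide by [t]: replacing [F] there by [F q] costs at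
    most [t L |z - q|^2], and [t] is arbitrarily small. *)
Lemma minty (C : set H) (F : H -> H) L q :
  convex_set (C : set (convex_lmodType H)) -> 0 <= L -> L.-lipschitz_C F ->
  C q ->
  (forall z, C z -> 0 <= ip (F z) (z - q)) -> SOL ip C F q.
Proof.
move=> Cx L0 FL Cq q_weak; split=> // z Cz.
have Q (t : R) : 0 < t -> t <= 1 ->
    - (t * (L * `|z - q| ^+ 2)) <= ip (F q) (z - q).
  move=> t0 t1; set u := q + t *: (z - q).
  have Cu : C u by apply: convex_set_segment => //; rewrite ltW.
  have uq : u - q = t *: (z - q) by rewrite /u addrC addKr.
  have := q_weak u Cu; rewrite uq ipZr pmulr_rge0// => Fu.
  have := FL (u, q) (conj Cu Cq); rewrite /= uq normrZ gtr0_norm// => Fuq.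
  have := ip_le hip (F u - F q) (z - q); rewrite ipDl ipNl.
  have := ler_wpM2r (normr_ge0 (z - q)) Fuq; lra.
apply/ler_addgt0Pl => e e0.
have K0 : 0 < L * `|z - q| ^+ 2 + 1 by rewrite ltr_wpDl// mulr_ge0// sqr_ge0.
pose t := Num.min 1 (e / (L * `|z - q| ^+ 2 + 1)).
have t0 : 0 < t by rewrite lt_min ltr01 divr_gt0.
have t1 : t <= 1 by rewrite ge_min lexx.
have te : t * (L * `|z - q| ^+ 2 + 1) <= e.
  by rewrite -ler_pdivlMr// ge_min lexx orbT.
by have := Q t t0 t1; lra.
Qed.

(** The half-space through the projection [P] of [q] with normal [q - P] contains [C], and its
    inequality survives the weak limit, giving [|q - P|^2 <= 0]. *)
Lemma closed_convex_weak_limit (C : set H) (T : Type) (G : set_system T)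
    (x : T -> H) q :
  C !=set0 -> closed C -> convex_set (C : set (convex_lmodType H)) ->
  ProperFilter G -> (forall t, C (x t)) ->
  (forall w, ip (x t) w @[t --> G] --> ip q w) -> C q.
Proof.
move=> C0 Cc Cx GP xC x_lim.
have [CP P_var] := metric_projP hip C0 Cc Cx q.
set P := metric_proj C q in CP P_var.
suff -> : q = P by [].
apply/eqP; rewrite -subr_eq0 -normr_eq0 -sqrf_eq0 -(ip_norm hip).
rewrite eq_le (ip_ge0 ip) andbT [leLHS]ipDl ipNl subr_le0.
apply: (cvgr_to_le (x_lim (q - P))); near=> t.
by have := P_var _ (xC t); rewrite ipDr ipNr !(ipC ip (q - P)); lra.
Unshelve. all: by end_near.
Qed.

End Extragradient.

(** * Convergence of the perturbed method *)

Theorem theorem4p3 (R : realType) (H : completeNormedModType R)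
    (ip : {dot H for idfun}) (hip : norm_induced_by ip)
    (C : set H) (C_neq0 : C !=set0) (C_closed : closed C)
    (C_convex : convex_set (C : set (convex_lmodType H)))
    (F : H -> H)
    (SOL_neq0 : SOL ip C F !=set0)
    (F_monotone : monotone_on ip C F)
    (L : R) (L_gt0 : 0 < L) (F_lipschitz : L.-lipschitz_C F)
    (sigma rho mu : R) (sigma_gt0 : 0 < sigma)
    (rho_gt0 : 0 < rho) (rho_lt1 : rho < 1)
    (mu_gt0 : 0 < mu) (mu_lt1 : mu < 1)
    (v : nat -> H) (v_bounded : bounded_fun v)
    (lam : nat -> R) (lam_ge0 : forall k : nat, 0 <= lam k)
    (lam_summable : cvgn (series lam))
    (x y : nat -> H) (m : nat -> nat)
    (x_generated : perturbed_extragradient C F sigma rho mu lam v x y m)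
    (perturbed_in_C : forall k : nat, C (x k + lam k *: v k)) :
  exists2 p : H, SOL ip C F p & weakly_cvg_to ip x p.
Proof.
have [M0 M0_ge0 v_le] := bounded_fun_le v_bounded.
have [xC0 x_step] := x_generated.
pose w k := x k + lam k *: v k.
pose gam k := sigma * rho ^+ m k.
pose e k := M0 * lam k.
pose c := 8 * mu ^+ 2 / (1 - mu).
have mu1 : 0 < 1 - mu by rewrite subr_gt0.
have c0 : 0 <= c by rewrite divr_ge0 ?mulr_ge0 ?sqr_ge0// ltW.
have e0 k : 0 <= e k by rewrite mulr_ge0.
have e_series s : cvgn (series (fun k => s * e k)).
  by apply: is_cvg_seriesZ; exact: is_cvg_seriesZ.
have e_cvg0 : e @ \oo --> 0.
  by apply: cvg_series_cvg_0; exact: is_cvg_seriesZ.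
have lamv_le k : lam k * `|v k| <= e k by rewrite /e mulrC ler_wpM2r.
have xw_le k : `|w k - x k| <= e k.
  by rewrite /w addrC addKr normrZ ger0_norm.
have gam_gt0 k : 0 < gam k by rewrite mulr_gt0// exprn_gt0.
have projP := metric_projP hip C_neq0 C_closed C_convex.
have y_def k : y k = metric_proj C (w k - gam k *: F (w k)).
  by have [] := x_step k.
have x_def k : x k.+1 = metric_proj C (w k - gam k *: F (y k)).
  by have [] := x_step k.
have yC k : C (y k) by rewrite y_def; have [] := projP (w k - gam k *: F (w k)).
have xC k : C (x k).
  by case: k => // k; rewrite x_def; have [] := projP (w k - gam k *: F (y k)).
have y_var k z : C z -> ip (w k - gam k *: F (w k) - y k) (z - y k) <= 0.
  by rewrite y_def; have [_] := projP (w k - gam k *: F (w k)); exact.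
have x_var k z : C z -> ip (w k - gam k *: F (y k) - x k.+1) (z - x k.+1) <= 0.
  by rewrite x_def; have [_] := projP (w k - gam k *: F (y k)); exact.
(* One [e k] comes from replacing [x k] by [w k], the other from [lam k * |v k|]. *)
have step_ok k : gam k * `|F (w k) - F (y k)| <= mu * (`|w k - y k| + 2 * e k).
  have [ok _ _ _] := x_step k; move: ok.
  rewrite /eg_step_ok /eg_trial -/(w k) -/(gam k) -y_def => /le_trans; apply.
  rewrite ler_pM2l//.
  have : `|x k - y k| <= `|w k - x k| + `|w k - y k|.
    rewrite -(normrN (w k - x k)) opprB.
    by rewrite (le_trans _ (ler_normD _ _))// subrKA.
  have := xw_le k; have := lamv_le k; lra.
have [g g_gt0 g_le] : exists2 g, 0 < g & forall k, g <= gam k.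
  (* Either [m k = 0] and the step is [sigma], or the exponent [m k - 1] was rejected, so its step
     exceeds [mu / L] and one more factor [rho] gives [gam k]. *)
  exists (Num.min sigma (rho * mu / L)).
    by rewrite lt_min sigma_gt0 divr_gt0// mulr_gt0.
  move=> k; rewrite ge_min /gam; case mk : (m k) => [|j].
    by rewrite expr0 mulr1 lexx.
  have [_ /(_ j) fail _ _] := x_step k; rewrite mk in fail.
  have := failed_step_bound hip C_neq0 C_closed C_convex F_lipschitz
    (ltW mu_gt0) (ltW (mulr_gt0 sigma_gt0 (exprn_gt0 j rho_gt0))) (lam_ge0 k)
    (perturbed_in_C k) (fail (leqnn _)) => h.
  apply/orP; right; rewrite ler_pdivrMr// exprS mulrCA -mulrA ler_pM2l//.
  by rewrite ltW// mulrA.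
have descent p : SOL ip C F p -> forall k,
    `|x k.+1 - p| ^+ 2 <=
      `|w k - p| ^+ 2 - (1 - mu) * `|w k - y k| ^+ 2 + c * e k ^+ 2.
  move=> [Cp p_sol] k.
  apply: (extragradient_descent hip (gamma := gam k)
    (fw := F (w k)) (fy := F (y k))) => //.
  - exact: ltW.
  - exact: y_var.
  - exact: x_var.
  - have := F_monotone _ _ (yC k) Cp; have := p_sol _ (yC k).
    by rewrite (ipDl ip (F (y k))) ipNl; lra.
have wp_le p k : `|w k - p| <= `|x k - p| + e k.
  have -> : w k - p = (w k - x k) + (x k - p) by rewrite subrKA.
  by rewrite (le_trans (ler_normD _ _))// addrC lerD2l.
have dist_cvg p : SOL ip C F p -> cvgn (fun k => `|x k - p|).
  move=> p_sol.
  (* The 1 accounts for passing from [w k] to [x k]; the root of [c] arises from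
     [A^2 + c e^2 <= (A + sqrt c e)^2] for nonnegative [A] and [e]. *)
  apply: (@quasi_fejer_cvg _ _ (fun k => (1 + Num.sqrt c) * e k)) => //.
    by move=> k; rewrite mulr_ge0// addr_ge0// sqrtr_ge0.
  move=> k; have s0 : 0 <= Num.sqrt c := sqrtr_ge0 c.
  rewrite -(ler_pXn2r (n := 2)) ?nnegrE ?addr_ge0 ?mulr_ge0 ?addr_ge0//.
  apply: le_trans (descent p p_sol k) _.
  have : 0 <= (1 - mu) * `|w k - y k| ^+ 2 by rewrite mulr_ge0 ?sqr_ge0 ?ltW.
  have : `|w k - p| ^+ 2 <= (`|x k - p| + e k) ^+ 2.
    by rewrite ler_pXn2r ?nnegrE ?addr_ge0.
  have : 0 <= 2 * ((`|x k - p| + e k) * (Num.sqrt c * e k)).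
    by rewrite !mulr_ge0 ?addr_ge0.
  have : (Num.sqrt c * e k) ^+ 2 = c * e k ^+ 2 by rewrite exprMn sqr_sqrtr.
  nra.
have [p0 p0_sol] := SOL_neq0.
have [D D0 xp0_le] : exists2 D, 0 <= D & forall k, `|x k - p0| <= D.
  have [D D0 xD] := bounded_fun_le (cvg_seq_bounded (dist_cvg _ p0_sol)).
  by exists D => // k; have := xD k; rewrite normr_id.
have [E E0 e_le] : exists2 E, 0 <= E & forall k, e k <= E.
  have [E E0 eE] := bounded_fun_le (cvg_seq_bounded (cvgP _ e_cvg0)).
  by exists E => // k; have := eE k; rewrite ger0_norm.
have wy_cvg0 : `|w k - y k| @[k --> \oo] --> (0 : R).
  have /cvg_ex[d d_cvg] := dist_cvg _ p0_sol.
  (* This is the descent inequality solved for [|w k - y k|^2]; the two distances to [p0] have the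
     same limit, so [b] tends to 0. *)
  pose b k := (1 - mu)^-1 *
    ((`|x k - p0| + e k) ^+ 2 + c * e k ^+ 2 - `|x k.+1 - p0| ^+ 2).
  have b_cvg0 : b @ \oo --> 0.
    have dS_cvg : `|x k.+1 - p0| @[k --> \oo] --> d.
      by rewrite (cvg_shiftS (fun k => `|x k - p0|)).
    rewrite (_ : 0 = (1 - mu)^-1 * ((d + 0) ^+ 2 + c * 0 ^+ 2 - d ^+ 2));
      last by ring.
    apply: cvgM; first exact: cvg_cst.
    apply: cvgB; last by rewrite expr2; exact: cvgM.
    apply: cvgD; first by rewrite expr2; apply: cvgM; exact: cvgD.
    by apply: cvgM; [exact: cvg_cst|rewrite expr2; exact: cvgM].
  have wy_le k : `|w k - y k| ^+ 2 <= b k.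
    rewrite -(ler_pM2l mu1) /b mulVKf ?gt_eqF//.
    have := descent _ p0_sol k.
    have : `|w k - p0| ^+ 2 <= (`|x k - p0| + e k) ^+ 2.
      by rewrite ler_pXn2r ?nnegrE ?addr_ge0.
    lra.
  apply/cvgr0Pnorm_lt => eps eps0; near=> k; rewrite normr_id.
  rewrite -(ltr_pXn2r (n := 2)) ?nnegrE ?(ltW eps0)//.
  apply: le_lt_trans (wy_le k) _; apply: le_lt_trans (ler_norm _) _.
  by near: k; apply: cvgr0_norm_lt => //; exact: exprn_gt0.
have xM k : `|x k| <= D + `|p0|.
  by rewrite -[x k](subrK p0) (le_trans (ler_normD _ _))// lerD2r.
apply: (opial hip xM dist_cvg) => G q GU ooG x_lim.
have Cq : C q.
  exact: (closed_convex_weak_limit hip C_neq0 C_closed C_convex _ xC x_lim).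
have xw_cvg u : ip (w k - x k) u @[k --> \oo] --> (0 : R).
  apply/norm_cvg0P.
  apply: (@squeeze_cvgr _ _ _ _ (fun=> 0) (fun k => e k * `|u|)).
  - near=> k; rewrite normr_ge0 /= (le_trans (normr_ip_le hip _ _))//.
    by rewrite ler_wpM2r.
  - exact: cvg_cst.
  - by rewrite -(mul0r `|u|); apply: cvgM => //; exact: cvg_cst.
have w_lim u : ip (w k) u @[k --> G] --> ip q u.
  rewrite (_ : (fun k => _) = fun k => ip (x k) u + ip (w k - x k) u);
    last first.
    by apply/funext => k; rewrite -ipDl addrC subrK.
  rewrite -[ip q u]addr0; apply: cvgD => //.
  exact: cvg_trans (cvg_app _ ooG) (xw_cvg u).
apply: (minty hip C_convex (ltW L_gt0) F_lipschitz Cq) => z Cz.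
(* [K1] bounds [|z - w k|], [K2] bounds [|F (w k)|], and [r], with [r 0 = 0], is the error caused by
   [y k] differing from [w k]. *)
pose K1 := `|z - p0| + D + E.
pose K2 := `|F p0| + L * (D + E).
pose r a := g^-1 * (a * (K1 + a)) + K2 * a.
have wp_bnd k : `|w k - p0| <= D + E.
  by have := wp_le p0 k; have := xp0_le k; have := e_le k; lra.
have Fw_le k : `|F (w k)| <= K2.
  have := F_lipschitz (w k, p0) (conj (perturbed_in_C k) p0_sol.1) => /= Fwp.
  rewrite -[F (w k)](subrK (F p0)) (le_trans (ler_normD _ _))// addrC lerD2l.
  by apply: le_trans Fwp _; rewrite ler_pM2l.
have zy_le k : `|z - y k| <= K1 + `|w k - y k|.
  have -> : z - y k = (z - p0) - (w k - p0) + (w k - y k).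
    by rewrite opprB subrKA subrKA.
  rewrite (le_trans (ler_normD _ _))// lerD2r (le_trans (ler_normB _ _))//.
  by have := wp_bnd k; rewrite /K1; lra.
(* Monotonicity replaces [F z] by [F (w k)]; moving from [w k] to [y k] costs [K2 a], and the
   projection inequality at [y k] bounds the rest. *)
have key k : 0 <= ip (F z) (z - w k) + r `|w k - y k|.
  have wC := perturbed_in_C k; rewrite -/(w k) in wC.
  have mono := F_monotone _ _ Cz wC.
  have yv := y_var k z Cz.
  set a := `|w k - y k|.
  have a0 : 0 <= a by exact: normr_ge0.
  set s := ip (F (w k)) (z - y k).
  have gs : - (a * (K1 + a)) <= gam k * s.
    have -> : gam k * s = ip (w k - y k) (z - y k)
       - ip (w k - gam k *: F (w k) - y k) (z - y k).
      by rewrite !(ipDl, ipNl, ipZl) /s; ring.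
    have := ip_le hip (- (w k - y k)) (z - y k); rewrite ipNl normrN -/a.
    have := ler_wpM2l a0 (zy_le k); rewrite -/a.
    lra.
  (* Only a negative [s] matters, and then [g * s >= gam k * s] because [g <= gam k]. *)
  have s_ge : 0 <= s + g^-1 * (a * (K1 + a)).
    have aK : 0 <= a * (K1 + a) by rewrite mulr_ge0// !addr_ge0.
    have [s0|s0] := leP 0 s.
      by rewrite addr_ge0// mulr_ge0// invr_ge0 ltW.
    rewrite -(pmulr_rge0 _ g_gt0) mulrDr mulVKf ?gt_eqF//.
    have := g_le k; nra.
  have := ip_le hip (F (w k)) (- (y k - w k)); rewrite ipNr normrN distrC -/a.
  have := ler_wpM2r a0 (Fw_le k).
  move: mono; rewrite (ipDl ip (F z)) ipNl /r.
  have -> : ip (F (w k)) (z - w k) = s + ip (F (w k)) (y k - w k).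
    by rewrite /s -ipDr subrKA.
  lra.
have lim : ip (F z) (z - w k) + r `|w k - y k| @[k --> G]
    --> ip (F z) (z - q) + r 0.
  apply: cvgD.
    rewrite (_ : (fun k => _) = fun k => ip z (F z) - ip (w k) (F z));
      last first.
      by apply/funext => k; rewrite (ipC ip (F z)) ipDl ipNl.
    by rewrite (ipC ip (F z)) ipDl ipNl; apply: cvgB => //; exact: cvg_cst.
  have wy_G := cvg_trans (cvg_app _ ooG) wy_cvg0.
  apply: cvgD; apply: cvgM => //; try exact: cvg_cst.
  by apply: cvgM => //; apply: cvgD => //; exact: cvg_cst.
rewrite /r mul0r !mulr0 !addr0 in lim.
by apply: (cvgr_to_ge lim); near=> k; exact: key.
Unshelve. all: by end_near.
Qed.
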